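(* Let $I$ be a set of unary connectives with $I\cap\mathcal{L}=\emptyset$, where $\mathcal{L}=\{\vee,\to,\cdot,0,1\}$, and suppose that $\mathbf{L}$ is an axiomatic extension of $S_{\mathcal{H}}$ that is algebraized by the subvariety $\mathcal{V}$ of $\mathcal{R}(I)$. Let $\Gamma\cup\Delta\cup\{\psi\}$ be a set of formulas in the language $\mathcal{L}(I)=\mathcal{L}\cup I$. Then $\Gamma,\Delta\vdash_{\mathbf{L}}\psi$ if and only if for some $n\geq 0$ there exist I-blocks $M_{1},\ldots,M_{n}$ and formulas $\psi_{1},\ldots,\psi_{n}\in\Delta$ such that $\Gamma\vdash_{\mathbf{L}}\prod_{j=1}^{n}M_{j}(\psi_{j})\rightarrow\psi$.
   Context: A ririg is an algebra $(A,\vee,\cdot,\to,0,1)$ such that $(A,\vee,0)$ and $(A,\cdot,1)$ are commutative monoids, $x\cdot 0=0$, $x\cdot(y\vee z)=(x\cdot y)\vee(x\cdot z)$ and $1\vee x=1$ for all $x,y,z$ (order: $x\leq y$ iff $x\vee y=y$), and $a\cdot b\leq c$ iff $a\leq b\to c$. A modal operator on a ririg is a unary operation $m$ with $m(1)=1$ and $m(x\to y)\leq m(x)\to m(y)$. An I-modal ririg is a ririg with a modal operator $m$ for each $m\in I$; $\mathcal{R}(I)$ is the variety of all of them. Formulas are over a countably infinite set of variables in the language $\mathcal{L}(I)$, with algebra of formulas $\mathbf{Fm}$. Write $\bot$ for the constant $0$, and $\top:=\bot\to\bot$; the constant $1$ is identified with $\top$. A statement $\varphi\leftrightarrow\psi$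 abbreviates the two formulas $\varphi\to\psi$ and $\psi\to\varphi$. The Hilbert calculus $\mathcal{H}$ has the axiom schemes: (1) $\varphi\to\varphi$; (2) $(\varphi\to\psi)\to[(\psi\to\chi)\to(\varphi\to\chi)]$; (3) $\varphi\cdot\psi\to\varphi$; (4) $\varphi\cdot\psi\to\psi\cdot\varphi$; (5) $[(\varphi\cdot\psi)\to\chi]\to[\psi\to(\varphi\to\chi)]$; (6) $[\psi\to(\varphi\to\chi)]\to[(\varphi\cdot\psi)\to\chi]$; (7) $\varphi\to(\varphi\vee\psi)$; (8) $\psi\to(\varphi\vee\psi)$; (9) $\varphi\cdot(\psi\vee\chi)\to[(\varphi\cdot\psi)\vee(\varphi\cdot\chi)]$; (10) $\bot\to\varphi$; and, for every $m\in I$, ($m$11) $m(\top)\leftrightarrow\top$; ($m$12) $m(\varphi\to\psi)\to(m(\varphi)\to m(\psi))$. Its rules are: from $\varphi\to\psi$ and $\varphi$ infer $\psi$; from $\varphi$ infer $m(\varphi)$ (for every $m\in I$); from $\varphi\to\chi$ and $\psi\to\chi$ infer $(\varphi\vee\psi)\to\chi$. $S_{\mathcal{H}}$ is the deductive system in which $\Gamma\vdash_{S_{\mathcal{H}}}\varphi$ iff there is a finite $\mathcal{H}$-deduction of $\varphi$ from finitely many formulas of $\Gamma$ (rules applicable to any previously derived formulas). An axiomatic extension of $S_{\mathcal{H}}$ is obtained by adding a set of formulas closed under substitution as further axioms, keeping the rules. That $\mathbf{L}$ is algebraized by $\mathcal{V}$ means it is algebraizable in the sense of Blok–Pigozzi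 with equivalent algebraic semantics $\mathcal{V}$ via the transformers $\varphi\mapsto\{\varphi\approx 1\}$ and $\varphi\approx\psi\mapsto\{\varphi\to\psi,\psi\to\varphi\}$; in particular $\Gamma\vdash_{\mathbf{L}}\varphi$ iff for every $\mathbf{A}\in\mathcal{V}$ and every homomorphism $v:\mathbf{Fm}\to\mathbf{A}$, $v(\gamma)=1$ for all $\gamma\in\Gamma$ implies $v(\varphi)=1$. An I-block is a finite (possibly empty) word $M=m_1\cdots m_r$ in the alphabet $I$; $M(\varphi)$ denotes $m_1(m_2(\cdots m_r(\varphi)))$, with $M(\varphi)=\varphi$ for the empty word. $\prod_{j=1}^n\varphi_j$ denotes $\varphi_1\cdot\ldots\cdot\varphi_n$, and the empty product is $1$. The $\psi_j$ need not be distinct. $\Gamma,\Delta$ stands for $\Gamma\cup\Delta$. *)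

(* Defs.v *)
From mathcomp Require Import all_boot classical_sets.

Set Implicit Arguments.
Unset Strict Implicit.
Unset Printing Implicit Defensive.

Local Open Scope classical_set_scope.

(* The connectives of L and those of I are different constructors, which
   encodes the disjointness of I from L.  The constant 1 is not a constructor:
   it is identified with Top := Bot -> Bot. *)
Inductive formula (I : Type) : Type :=
| Var of nat
| Bot
| Or of formula I & formula I
| Mul of formula I & formula I
| Imp of formula I & formula I
| Mod of I & formula I.

Arguments Var {I} _.
Arguments Bot {I}.

Declare Scope formula_scope.
Delimit Scope formula_scope with F.
Bind Scope formula_scope with formula.
Notation "a ⊔ b" := (Or a b) (at level 50, left associativity) : formula_scope.
Notation "a ⊙ b" := (Mul a b) (at level 40, left associativity) : formula_scope.
Notation "a ⇒ b" := (Imp a b) (at level 60, right associativity) : formula_scope.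
Local Open Scope formula_scope.

Definition Top {I : Type} : formula I := Bot ⇒ Bot.

Fixpoint subst (I : Type) (s : nat -> formula I) (a : formula I) : formula I :=
  match a with
  | Var k => s k
  | Bot => Bot
  | a ⊔ b => subst s a ⊔ subst s b
  | a ⊙ b => subst s a ⊙ subst s b
  | a ⇒ b => subst s a ⇒ subst s b
  | Mod m a => Mod m (subst s a)
  end.

Definition subst_closed (I : Type) (Ax : set (formula I)) : Prop :=
  forall (s : nat -> formula I) (a : formula I), Ax a -> Ax (subst s a).

Inductive H_axiom (I : Type) : formula I -> Prop :=
| H1 a : H_axiom (a ⇒ a)
| H2 a b c : H_axiom ((a ⇒ b) ⇒ ((b ⇒ c) ⇒ (a ⇒ c)))
| H3 a b : H_axiom ((a ⊙ b) ⇒ a)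
| H4 a b : H_axiom ((a ⊙ b) ⇒ (b ⊙ a))
| H5 a b c : H_axiom (((a ⊙ b) ⇒ c) ⇒ (b ⇒ (a ⇒ c)))
| H6 a b c : H_axiom ((b ⇒ (a ⇒ c)) ⇒ ((a ⊙ b) ⇒ c))
| H7 a b : H_axiom (a ⇒ (a ⊔ b))
| H8 a b : H_axiom (b ⇒ (a ⊔ b))
| H9 a b c : H_axiom ((a ⊙ (b ⊔ c)) ⇒ ((a ⊙ b) ⊔ (a ⊙ c)))
| H10 a : H_axiom (Bot ⇒ a)
| H11l m : H_axiom (Mod m Top ⇒ Top)
| H11r m : H_axiom (Top ⇒ Mod m Top)
| H12 m a b : H_axiom (Mod m (a ⇒ b) ⇒ (Mod m a ⇒ Mod m b)).

(* Derivability from the premises G in the calculus H with the additional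
   axioms Ax.  All the rules apply to arbitrary derived formulas, not only to
   theorems. *)
Inductive derivable (I : Type) (Ax G : set (formula I)) : formula I -> Prop :=
| d_hyp a : G a -> derivable Ax G a
| d_H a : H_axiom a -> derivable Ax G a
| d_ext a : Ax a -> derivable Ax G a
| d_mp a b : derivable Ax G (a ⇒ b) -> derivable Ax G a -> derivable Ax G b
| d_nec m a : derivable Ax G a -> derivable Ax G (Mod m a)
| d_or a b c : derivable Ax G (a ⇒ c) -> derivable Ax G (b ⇒ c) ->
    derivable Ax G ((a ⊔ b) ⇒ c).

Definition axiomatic_extension (I : Type)
    (L : set (formula I) -> formula I -> Prop) : Prop :=
  exists2 Ax : set (formula I), subst_closed Ax &
    forall (G : set (formula I)) (a : formula I), L G a <-> derivable Ax G a.

Record ririg : Type := Ririg {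
  carrier :> Type;
  rjoin : carrier -> carrier -> carrier;
  rmul : carrier -> carrier -> carrier;
  rimp : carrier -> carrier -> carrier;
  rzero : carrier;
  rone : carrier;
  rjoinA : associative rjoin;
  rjoinC : commutative rjoin;
  rjoin0 : left_id rzero rjoin;
  rmulA : associative rmul;
  rmulC : commutative rmul;
  rmul1 : left_id rone rmul;
  rmul0 : right_zero rzero rmul;
  rmul_joinr : right_distributive rmul rjoin;
  rjoin1 : left_zero rone rjoin;
  rresiduation : forall a b c,
    rjoin (rmul a b) c = c <-> rjoin a (rimp b c) = rimp b c
}.

Arguments rzero {r}.
Arguments rone {r}.

Definition rle (A : ririg) (x y : A) : Prop := rjoin x y = y.

Definition modal_operator (A : ririg) (m : A -> A) : Prop :=
  m rone = rone /\ forall x y : A, rle (m (rimp x y)) (rimp (m x) (m y)).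

Record modal_ririg (I : Type) : Type := ModalRirig {
  base :> ririg;
  rmod : I -> base -> base;
  rmodP : forall m : I, modal_operator (rmod m)
}.

Record hom (I : Type) (A : modal_ririg I) (v : formula I -> A) : Prop := Hom {
  hom_bot : v Bot = rzero;
  hom_top : v Top = rone;
  hom_or : forall a b, v (a ⊔ b) = rjoin (v a) (v b);
  hom_mul : forall a b, v (a ⊙ b) = rmul (v a) (v b);
  hom_imp : forall a b, v (a ⇒ b) = rimp (v a) (v b);
  hom_mod : forall m a, v (Mod m a) = rmod m (v a)
}.

Definition equation (I : Type) : Type := (formula I * formula I)%type.

Definition valid (I : Type) (A : modal_ririg I) (e : equation I) : Prop :=
  forall v : formula I -> A, hom v -> v e.1 = v e.2.

(* A subvariety of the variety of all I-modal ririgs is an equational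
   subclass. *)
Definition subvariety (I : Type) (V : modal_ririg I -> Prop) : Prop :=
  exists E : set (equation I),
    forall A : modal_ririg I, V A <-> (forall e, E e -> valid A e).

Definition eq_consequence (I : Type) (V : modal_ririg I -> Prop)
    (E : set (equation I)) (e : equation I) : Prop :=
  forall A : modal_ririg I, V A -> forall v : formula I -> A, hom v ->
    (forall e', E e' -> v e'.1 = v e'.2) -> v e.1 = v e.2.

(* Blok-Pigozzi: V is an equivalent algebraic semantics of L, with defining
   equation a ≈ 1 and equivalence formulas a -> b, b -> a. *)
Record algebraized (I : Type) (L : set (formula I) -> formula I -> Prop)
    (V : modal_ririg I -> Prop) : Prop := Algebraized {
  algebraic_semantics : forall (G : set (formula I)) (a : formula I),
    L G a <-> eq_consequence V [set (g, Top) | g in G] (a, Top);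
  equivalence_elim : forall a b : formula I,
    eq_consequence V [set (a, b)] (a ⇒ b, Top) /\
    eq_consequence V [set (a, b)] (b ⇒ a, Top);
  equivalence_intro : forall a b : formula I,
    eq_consequence V [set (a ⇒ b, Top); (b ⇒ a, Top)] (a, b)
}.

Definition block (I : Type) (M : seq I) (a : formula I) : formula I :=
  foldr (@Mod I) a M.

(* a_1 · ... · a_n, bracketed to the left and without a trailing factor 1. *)
Definition prods (I : Type) (s : seq (formula I)) : formula I :=
  if s is a :: s' then foldl (@Mul I) a s' else Top.

Definition prod_ord (I : Type) (n : nat) (a : 'I_n -> formula I) : formula I :=
  prods [seq a j | j <- enum 'I_n].

(* Main.v *)
Require Import Defs.
From mathcomp Require Import all_boot classical_sets.

Local Open Scope classical_set_scope.

(** Since [L] is derivability in the calculus with some extra axioms, the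
    theorem is a statement about derivations.

    From right to left, every element of [Delta] may be necessitated along a
    block, and derivable formulas may be multiplied, so the product is derivable
    from [Gamma] and [Delta] and is then detached.

    From left to right the argument is by induction on the derivation of [psi].
    What makes it work is that the products of blocks of elements of [Delta] are
    stable under everything that the rules ask of them: two of them, sitting in
    front of two premises, combine into one by concatenation ([prods_cat]); and
    prefixing every block of such a product by [m] gives a formula that implies
    [m] of the product ([prods_Mod]), because [m] is monotone and
    super-multiplicative, which is axiom 12 read through residuation.  The
    disjunction rule survives a side formula [p] in front of its premises because
    fusion distributes over disjunction ([imp_or]).  There is no contraction,
    whence the repetitions among the factors. *)

(** * Residuated order on formulas *)

Lemma imp_refl {I} {Ax G : set (formula I)} a : derivable Ax G (a ⇒ a).
Proof. exact: d_H _ _ (H1 _). Qed.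

Lemma imp_trans {I} {Ax G : set (formula I)} {a} b {c} :
  derivable Ax G (a ⇒ b) -> derivable Ax G (b ⇒ c) -> derivable Ax G (a ⇒ c).
Proof.
by move=> ab; apply: d_mp; apply: d_mp _ ab; exact: d_H _ _ (H2 _ _ _).
Qed.

Lemma curry {I} {Ax G : set (formula I)} {a b c} :
  derivable Ax G (a ⊙ b ⇒ c) -> derivable Ax G (b ⇒ a ⇒ c).
Proof. exact: d_mp (d_H _ _ (H5 _ _ _)). Qed.

Lemma uncurry {I} {Ax G : set (formula I)} {a b c} :
  derivable Ax G (b ⇒ a ⇒ c) -> derivable Ax G (a ⊙ b ⇒ c).
Proof. exact: d_mp (d_H _ _ (H6 _ _ _)). Qed.

Lemma mulC_imp {I} {Ax G : set (formula I)} a b :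
  derivable Ax G (a ⊙ b ⇒ b ⊙ a).
Proof. exact: d_H _ _ (H4 _ _). Qed.

Lemma weaken {I} {Ax G : set (formula I)} {a} b :
  derivable Ax G a -> derivable Ax G (b ⇒ a).
Proof.
apply: d_mp; apply: curry.
exact: imp_trans (mulC_imp _ _) (d_H _ _ (H3 _ _)).
Qed.

Lemma derivable_mul {I} {Ax G : set (formula I)} {a b} :
  derivable Ax G a -> derivable Ax G b -> derivable Ax G (a ⊙ b).
Proof. by move=> da; apply: d_mp; apply: d_mp _ da; apply/curry/mulC_imp. Qed.

Lemma imp_mul2r {I} {Ax G : set (formula I)} {a b} c :
  derivable Ax G (a ⇒ b) -> derivable Ax G (a ⊙ c ⇒ b ⊙ c).
Proof.
move=> ab; apply/uncurry/(imp_trans _ (curry (imp_refl _))).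
by apply: d_mp _ ab; exact: d_H _ _ (H2 _ _ _).
Qed.

Lemma imp_mul2l {I} {Ax G : set (formula I)} {a b} c :
  derivable Ax G (a ⇒ b) -> derivable Ax G (c ⊙ a ⇒ c ⊙ b).
Proof.
move=> ab; apply: imp_trans (mulC_imp _ _).
exact: imp_trans (mulC_imp _ _) (imp_mul2r c ab).
Qed.

Lemma mulA_imp {I} {Ax G : set (formula I)} a b c :
  derivable Ax G ((a ⊙ b) ⊙ c ⇒ a ⊙ (b ⊙ c)).
Proof.
apply/uncurry/(imp_trans _ _ (d_H _ _ (H6 _ _ _))).
exact/curry/curry/imp_refl.
Qed.

Lemma imp_mulTop {I} {Ax G : set (formula I)} a :
  derivable Ax G (a ⇒ a ⊙ Top).
Proof.
apply: (d_mp (a := Top)) (imp_refl _).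
exact/curry/imp_refl.
Qed.

(** The disjunction rule relative to a side formula [p]: residuation moves [p]
    into the antecedents, where the distributive law lets the rule act under
    it. *)
Lemma imp_or {I} {Ax G : set (formula I)} {p a b c} :
  derivable Ax G (p ⇒ a ⇒ c) -> derivable Ax G (p ⇒ b ⇒ c) ->
  derivable Ax G (p ⇒ a ⊔ b ⇒ c).
Proof.
move=> pac pbc; apply: curry; apply: imp_trans (mulC_imp _ _) _.
apply: imp_trans (d_H _ _ (H9 _ _ _)) _.
by apply: d_or; apply: imp_trans (mulC_imp _ _) (uncurry _).
Qed.

Lemma imp_Mod {I} {Ax G : set (formula I)} {a b} m :
  derivable Ax G (a ⇒ b) -> derivable Ax G (Mod m a ⇒ Mod m b).
Proof. by move/(d_nec m); apply: d_mp; exact: d_H _ _ (H12 _ _ _). Qed.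

(** This is the residuated form of the normality axiom, applied to
    [b ⇒ (a ⇒ a ⊙ b)]. *)
Lemma Mod_mul {I} {Ax G : set (formula I)} m a b :
  derivable Ax G (Mod m a ⊙ Mod m b ⇒ Mod m (a ⊙ b)).
Proof.
apply/uncurry/(imp_trans _ _ (d_H _ _ (H12 _ _ _))).
exact/imp_Mod/curry/imp_refl.
Qed.

(** * Products of lists of formulas *)

(** A one-element product carries no factor [Top], so appending a factor to the
    empty product is multiplication only up to interderivability; this lemma
    and the next one hide that case distinction. *)
Lemma prods_rcons_mul {I} {Ax G : set (formula I)} (s : seq (formula I)) a :
  derivable Ax G (prods (rcons s a) ⇒ prods s ⊙ a).
Proof.
case: s => [|b s] /=; last by rewrite foldl_rcons; exact: imp_refl.
exact: imp_trans (imp_mulTop _) (mulC_imp _ _).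
Qed.

Lemma mul_prods_rcons {I} {Ax G : set (formula I)} (s : seq (formula I)) a :
  derivable Ax G (prods s ⊙ a ⇒ prods (rcons s a)).
Proof.
case: s => [|b s] /=; last by rewrite foldl_rcons; exact: imp_refl.
exact: imp_trans (mulC_imp _ _) (d_H _ _ (H3 _ _)).
Qed.

Lemma prods_cat {I} {Ax G : set (formula I)} (s t : seq (formula I)) :
  derivable Ax G (prods (s ++ t) ⇒ prods s ⊙ prods t).
Proof.
elim/last_ind: t => [|t a IH]; first by rewrite cats0; exact: imp_mulTop.
rewrite -rcons_cat; apply: imp_trans (prods_rcons_mul _ _) _.
apply: imp_trans (imp_mul2r a IH) _.
exact: imp_trans (mulA_imp _ _ _) (imp_mul2l _ (mul_prods_rcons _ _)).
Qed.

Lemma prods_Mod {I} {Ax G : set (formula I)} m (s : seq (formula I)) :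
  derivable Ax G (prods (map (Mod m) s) ⇒ Mod m (prods s)).
Proof.
elim/last_ind: s => [|s a IH]; first exact: d_H _ _ (H11r _).
rewrite map_rcons; apply: imp_trans (prods_rcons_mul _ _) _.
apply: imp_trans (imp_mul2r _ IH) _.
exact: imp_trans (Mod_mul _ _ _) (imp_Mod m (mul_prods_rcons _ _)).
Qed.

(** * Products of blocks and the deduction theorem *)

(** Membership in [D] is carried by the entries, so that concatenating lists or
    extending their blocks keeps it. *)
Definition block_list {I} (D : set (formula I)) : Type :=
  seq (seq I * {d : formula I | D d}).

Definition block_prod {I} {D : set (formula I)} (s : block_list D) : formula I :=
  prods [seq block p.1 (sval p.2) | p <- s].

Lemma derivable_block {I} {Ax G : set (formula I)} (M : seq I) {a} :
  derivable Ax G a -> derivable Ax G (block M a).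
Proof. by move=> da; elim: M => //= m M; exact: d_nec. Qed.

Lemma derivable_block_prod {I} {Ax G D : set (formula I)} (s : block_list D) :
  D `<=` G -> derivable Ax G (block_prod s).
Proof.
move=> DG; rewrite /block_prod; elim/last_ind: s => [|s [M [d Dd]] IH].
  exact: imp_refl.
rewrite map_rcons; apply: d_mp (mul_prods_rcons _ _) (derivable_mul IH _).
exact/derivable_block/d_hyp/DG.
Qed.

Lemma block_prod_cat {I} {Ax G D : set (formula I)} (s t : block_list D) :
  derivable Ax G (block_prod (s ++ t) ⇒ block_prod s ⊙ block_prod t).
Proof. by rewrite /block_prod map_cat; exact: prods_cat. Qed.

Lemma block_prod_Mod {I} {Ax G D : set (formula I)} m (s : block_list D) :
  derivable Ax G
    (block_prod [seq (m :: p.1, p.2) | p <- s] ⇒ Mod m (block_prod s)).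
Proof.
rewrite /block_prod -map_comp.
have := @prods_Mod I Ax G m [seq block p.1 (sval p.2) | p <- s].
by rewrite -map_comp.
Qed.

Lemma derivable_mono {I} {Ax G G' : set (formula I)} {a} :
  G `<=` G' -> derivable Ax G a -> derivable Ax G' a.
Proof.
move=> GG'; elim=> {a} [a /GG'|a|a|a b _ + _|m a _|a b c _ + _].
- exact: d_hyp.
- exact: d_H.
- exact: d_ext.
- exact: d_mp.
- exact: d_nec.
- exact: d_or.
Qed.

(** Induction on the derivation.  Axioms and members of [G] need only the empty
    product; a member of [D] is its own product, with the empty block. *)
Lemma deduction {I} {Ax G D : set (formula I)} {a} :
  derivable Ax (G `|` D) a ->
  exists s : block_list D, derivable Ax G (block_prod s ⇒ a).
Proof.
elim=> {a} [a [Ga|Da]|a Ha|a Aa|a b _ [s sab] _ [t ta]|m a _ [s sa]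
           |a b c _ [s sac] _ [t tbc]].
- by exists [::]; apply/weaken/d_hyp.
- by exists [:: ([::], exist _ a Da)]; exact: imp_refl.
- by exists [::]; apply/weaken/d_H.
- by exists [::]; apply/weaken/d_ext.
- exists (s ++ t); apply: imp_trans (block_prod_cat _ _) _.
  apply: imp_trans (imp_mul2l _ ta) _.
  exact: imp_trans (mulC_imp _ _) (uncurry sab).
- exists [seq (m :: p.1, p.2) | p <- s].
  exact: imp_trans (block_prod_Mod _ _) (imp_Mod m sa).
- exists (s ++ t); apply: imp_trans (block_prod_cat _ _) (imp_or _ _).
    exact: imp_trans (d_H _ _ (H3 _ _)) sac.
  apply: imp_trans (mulC_imp _ _) _.
  exact: imp_trans (d_H _ _ (H3 _ _)) tbc.
Qed.

Theorem theorem6p7 (I : Type) (L : set (formula I) -> formula I -> Prop)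
    (V : modal_ririg I -> Prop)
    (hL : axiomatic_extension L) (hV : subvariety V) (hLV : algebraized L V)
    (Gamma Delta : set (formula I)) (psi : formula I) :
  L (Gamma `|` Delta) psi <->
  exists (n : nat) (M : 'I_n -> seq I) (psis : 'I_n -> formula I),
    (forall j : 'I_n, Delta (psis j)) /\
    L Gamma (Imp (prod_ord (fun j : 'I_n => block (M j) (psis j))) psi).
Proof.
have [Ax _ LE] := hL; split=> [/LE/deduction[s spsi]|].
- exists (size s), (fun j => (tnth (in_tuple s) j).1).
  exists (fun j => sval (tnth (in_tuple s) j).2).
  split=> [j|]; first exact: svalP.
  apply/LE; move: spsi; rewrite /block_prod.
  by rewrite -[X in map _ X](map_tnth_enum (in_tuple s)) -map_comp.
- move=> [n [M [psis [Dpsis /LE Gpsi]]]]; apply/LE.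
  apply: d_mp (derivable_mono (@subsetUl _ _ _) Gpsi) _.
  pose s : block_list Delta :=
    [seq (M j, exist _ (psis j) (Dpsis j)) | j <- enum 'I_n].
  have := derivable_block_prod (Ax := Ax) s (@subsetUr _ Gamma Delta).
  by rewrite /block_prod -map_comp.
Qed.
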